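(* Let $O_1,\dots,O_n$ be i.i.d. from $P_0$, and let $\hat\Psi$ be an estimator of $\Psi(P_0)\in\mathbb{R}$ satisfying $\hat\Psi-\Psi(P_0)=\bar D_n+R_{\mathrm{rem}}$ with $\bar D_n=\frac1n\sum_{i=1}^nD^*(O_i)$, where $D^*\in L_0^2(P_0)$, $\sigma^2_{\mathrm{EIF}}=\mathbb{E}_{P_0}[(D^* )^2]\in(0,\infty)$, $\|D^*\|_\infty\le M<\infty$ almost surely, and $R_{\mathrm{rem}}=O_P(n^{-1/2})$. Suppose additionally that $n\,\mathrm{Cov}(\bar D_n,R_{\mathrm{rem}})\to0$. (i) If $n\,\mathrm{Var}(R_{\mathrm{rem}})\to0$, then $$\frac{\widehat{\mathrm{Var}}_{\mathrm{Sand}}(\hat\Psi)}{\mathrm{Var}(\hat\Psi-\Psi(P_0))}\xrightarrow{P}1.$$ (ii) If $n\,\mathrm{Var}(R_{\mathrm{rem}})\to c_R>0$, then the sandwich estimator targets only $\sigma^2_{\mathrm{EIF}}/n$ and underestimates the total variance by $c_R/n+o(n^{-1})$, i.e. $\mathrm{Var}(\hat\Psi-\Psi(P_0))-\sigma^2_{\mathrm{EIF}}/n=c_R/n+o(n^{-1})$.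
   Context: $\Psi:\mathcal P\to\mathbb R$ is a pathwise differentiable functional on a nonparametric model $\mathcal P$ with efficient influence function $D^*\in L^2_0(P_0)$ (mean-zero, square-integrable under $P_0$). $R_{\mathrm{rem}}$ is the second-order remainder, a random variable depending on the whole sample. The sandwich variance estimator $\widehat{\mathrm{Var}}_{\mathrm{Sand}}(\hat\Psi)$ is the usual influence-function-based estimator, built from the empirical second moment of the influence function divided by $n$; it targets $\sigma^2_{\mathrm{EIF}}/n$ in the sense that $n\,\widehat{\mathrm{Var}}_{\mathrm{Sand}}(\hat\Psi)\xrightarrow{P}\sigma^2_{\mathrm{EIF}}$. *)

(* Defs.v *)
From HB Require Import structures.
From mathcomp Require Import all_boot all_order all_algebra.
From mathcomp Require Import all_classical all_reals all_analysis.
Set Implicit Arguments.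
Unset Strict Implicit.
Unset Printing Implicit Defensive.
Import Order.TTheory GRing.Theory Num.Theory.
Import numFieldNormedType.Exports.
Local Open Scope classical_set_scope.
Local Open Scope ring_scope.

Definition L20 d (X : measurableType d) (R : realType) (P0 : probability X R) :
    set (X -> R) :=
  [set f | f \in Lfun P0 2%:E /\ ('E_P0[f] = 0)%E].

(* [p t] is a density of [Pt t] with respect to a common dominating measure
   [mu], and t |-> sqrt (p t) is differentiable in L^2(mu) at t = 0, with
   derivative s * sqrt (p 0) / 2 (differentiability in quadratic mean). *)
Definition has_score d (X : measurableType d) (R : realType)
    (Pt : R -> probability X R) (s : X -> R) : Prop :=
  exists (mu : {sigma_finite_measure set X -> \bar R}) (p : R -> X -> R),
  [/\ forall t, measurable_fun [set: X] (p t),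
      forall t x, 0 <= p t x,
      forall t (A : set X), measurable A ->
        Pt t A = (\int[mu]_(x in A) (p t x)%:E)%E &
      (\int[mu]_x (((Num.sqrt (p t x) - Num.sqrt (p 0 x)) / t
                    - 2^-1 * s x * Num.sqrt (p 0 x)) ^+ 2)%:E)%E
        @[t --> 0^'] --> 0%E].

(* Only the values of a path for t near 0 matter, so paths are total in t. *)
Definition regular_path d (X : measurableType d) (R : realType)
    (M : set (probability X R)) (P0 : probability X R)
    (Pt : R -> probability X R) (s : X -> R) : Prop :=
  [/\ Pt 0 = P0, \forall t \near 0, M (Pt t), L20 P0 s & has_score Pt s].

Definition scores d (X : measurableType d) (R : realType)
    (M : set (probability X R)) (P0 : probability X R) : set (X -> R) :=
  [set s | exists Pt, regular_path M P0 Pt s].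

(* The closed linear span of the scores in L^2_0(P0). *)
Definition tangent_space d (X : measurableType d) (R : realType)
    (M : set (probability X R)) (P0 : probability X R) : set (X -> R) :=
  [set h | L20 P0 h /\ forall eps : R, 0 < eps ->
    exists (k : nat) (a : 'I_k -> R) (s : 'I_k -> X -> R),
      (forall i, scores M P0 (s i)) /\
      (\int[P0]_x ((h x - \sum_(i < k) a i * s i x) ^+ 2)%:E < eps%:E)%E].

Definition nonparametric_at d (X : measurableType d) (R : realType)
    (M : set (probability X R)) (P0 : probability X R) : Prop :=
  M P0 /\ tangent_space M P0 = L20 P0.

(* Psi is only ever evaluated on the model M (for t near 0). *)
Definition is_gradient d (X : measurableType d) (R : realType)
    (M : set (probability X R)) (Psi : probability X R -> R)
    (P0 : probability X R) (D : X -> R) : Prop :=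
  L20 P0 D /\
  forall (Pt : R -> probability X R) (s : X -> R), regular_path M P0 Pt s ->
    (Psi (Pt t) - Psi P0) / t @[t --> 0^'] --> \int[P0]_x (D x * s x).

(* Pathwise differentiability of Psi at P0 is the existence of a gradient; the
   efficient influence function is the gradient lying in the tangent space. *)
Definition efficient_influence_function d (X : measurableType d)
    (R : realType) (M : set (probability X R)) (Psi : probability X R -> R)
    (P0 : probability X R) (D : X -> R) : Prop :=
  is_gradient M Psi P0 D /\ tangent_space M P0 D.

Definition mutually_independent d d' (Omega : measurableType d)
    (X : measurableType d') (R : realType) (P : probability Omega R)
    (O : nat -> {RV P >-> X}) : Prop :=
  forall (J : seq nat) (A : nat -> set X), uniq J ->
    (forall j, measurable (A j)) ->
    P (\bigcap_(j in [set` J]) (O j @^-1` A j)) =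
    (\prod_(j <- J) P (O j @^-1` A j))%E.

Definition iid_from d d' (Omega : measurableType d) (X : measurableType d')
    (R : realType) (P : probability Omega R) (O : nat -> {RV P >-> X})
    (P0 : probability X R) : Prop :=
  mutually_independent O /\
  forall i (A : set X), measurable A -> distribution P (O i) A = P0 A.

Definition sample d d' (Omega : measurableType d) (X : measurableType d')
    (R : realType) (P : probability Omega R) (O : nat -> {RV P >-> X})
    (n : nat) (w : Omega) : n.-tuple X := [tuple O i w | i < n].

Definition empirical_mean d d' (Omega : measurableType d)
    (X : measurableType d') (R : realType) (P : probability Omega R)
    (O : nat -> {RV P >-> X}) (f : X -> R) (n : nat) (w : Omega) : R :=
  n%:R^-1 * \sum_(i < n) f (O i w).

(* [Dhat n z] is the influence function used with the sample z of size n; it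
   may be an estimate computed from z, and the constant family
   [fun _ _ => D] gives the estimator built from D itself. *)
Definition sandwich d d' (Omega : measurableType d) (X : measurableType d')
    (R : realType) (P : probability Omega R) (O : nat -> {RV P >-> X})
    (Dhat : forall n, n.-tuple X -> X -> R) (n : nat) (w : Omega) : R :=
  empirical_mean O (fun x => Dhat n (sample O n w) x ^+ 2) n w / n%:R.

Definition cvg_in_prob d (Omega : measurableType d) (R : realType)
    (P : probability Omega R) (Y : nat -> Omega -> R) (l : R) : Prop :=
  forall eps : R, 0 < eps ->
    P [set w | eps < `|Y n w - l|] @[n --> \oo] --> 0%E.

(* Y n = O_P(a n) *)
Definition bigO_in_prob d (Omega : measurableType d) (R : realType)
    (P : probability Omega R) (Y : nat -> Omega -> R) (a : nat -> R) : Prop :=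
  forall eps : R, 0 < eps -> exists K : R,
    \forall n \near \oo, (P [set w | (K * a n < `|Y n w|)%R] <= eps%:E)%E.

(* Main.v *)
(* Expanding the square, n Var(err) = Var(D) + n Var(Rrem) + 2 n Cov(Dbar, Rrem),
   so n Var(err) tends to sigma2 + lim n Var(Rrem); both claims follow by
   comparison with n times the sandwich estimator.  For the estimator built from
   D itself, the convergence to sigma2 is the weak law of large numbers for the
   square-integrable function D^2, by Chebyshev's inequality. *)
Require Import Defs.
From HB Require Import structures.
From mathcomp Require Import all_boot all_order all_algebra.
From mathcomp Require Import all_classical all_reals all_analysis.
From mathcomp Require Import measurable_realfun ring lra.
Set Implicit Arguments.
Unset Strict Implicit.
Unset Printing Implicit Defensive.
Import Order.TTheory GRing.Theory Num.Theory.
Import numFieldNormedType.Exports.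
Local Open Scope classical_set_scope.
Local Open Scope ring_scope.

(** * Measurability and square-integrability preliminaries *)

Lemma cvg_natV (R : realType) : (n%:R^-1 : R) @[n --> \oo] --> (0 : R).
Proof. by rewrite -cvg_shiftS; exact: cvg_harmonic. Qed.

Lemma measurable_lt_dist d (T : measurableType d) (R : realType)
    (f : T -> R) (c eps : R) :
  measurable_fun [set: T] f -> measurable [set x | eps < `|f x - c|].
Proof.
move=> mf; have mlt : measurable_fun [set: T] (fun x => eps < `|f x - c|).
  apply: measurable_fun_ltr => //; apply: measurableT_comp => //.
  exact: measurable_funB.
by have := mlt measurableT [set true] I; rewrite setTI.
Qed.

Lemma sqr_integral_lty_Lfun2 d (T : measurableType d) (R : realType)
    (mu : {measure set T -> \bar R}) (f : T -> R) :
  measurable_fun [set: T] f -> (\int[mu]_x (f x ^+ 2)%:E < +oo)%E ->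
  f \in Lfun mu 2%:E.
Proof.
move=> mf foo; rewrite inE; apply/andP; split; first by rewrite inE.
rewrite inE /= /finite_norm unlock; apply: poweR_lty.
under eq_integral => x _ do rewrite /= powR_mulrn// -normrX ger0_norm ?sqr_ge0//.
by [].
Qed.

Lemma Lfun2_measurable d (T : measurableType d) (R : realType)
    (mu : {measure set T -> \bar R}) (f : T -> R) :
  f \in Lfun mu 2%:E -> measurable_fun [set: T] f.
Proof. by move/sub_Lfun_mfun; rewrite inE. Qed.

Lemma Lfun2_Lfun1 d (T : measurableType d) (R : realType)
    (P : probability T R) (f : T -> R) :
  f \in Lfun P 2%:E -> f \in Lfun P 1.
Proof. by apply: Lfun_subset12; exact: fin_num_measure. Qed.

(* Junk value: the expectation of [X] may be infinite or undefined; its [fine]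
   is a real number in all cases, which is all the argument needs. *)
Lemma variance_lty_Lfun2 d (T : measurableType d) (R : realType)
    (P : probability T R) (X : {RV P >-> R}) :
  ('V_P[X] < +oo)%E -> (X : T -> R) \in Lfun P 2%:E.
Proof.
rewrite /variance unlock; set c := fine _; rewrite unlock => Voo.
have X2 : (X \- cst c : T -> R) \in Lfun P 2%:E.
  by apply: sqr_integral_lty_Lfun2 => //; exact: measurable_funB.
(* Constants are square integrable for a probability, so membership passes from the shifted variable
   back to [X]. *)
rewrite (_ : (X : T -> R) = (X \- cst c) \+ cst c); last first.
  by apply/funext => w /=; rewrite subrK.
by rewrite rpredD ?lee1n//= => _; rewrite Lfun_cst.
Qed.

(** The fourth power of [f] is dominated almost everywhere by a constant, which a probability
    integrates. Applied to [D], this gives [D ^+ 2] the finite variance that Chebyshev's inequality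
    requires. *)
Lemma ae_bounded_Lfun2_sqr d (T : measurableType d) (R : realType)
    (P : probability T R) (f : T -> R) (M : R) :
  measurable_fun [set: T] f -> {ae P, forall x, `|f x| <= M} ->
  (fun x => f x ^+ 2) \in Lfun P 2%:E.
Proof.
move=> mf fM; have mf2 := measurable_funX 2 mf.
apply: sqr_integral_lty_Lfun2 => //.
apply: (@le_lt_trans _ _ (\int[P]_x (cst ((M ^+ 2) ^+ 2)%:E x))%E); last first.
  by rewrite integral_cst//= probability_setT mule1 ltry.
apply: ae_ge0_le_integral => //.
- by move=> x _; rewrite lee_fin sqr_ge0.
- by apply/measurable_EFinP; exact: measurable_funX.
- by move=> x _; rewrite lee_fin sqr_ge0.
apply: filterS fM => x fxM _ /=.
rewrite lee_fin lerXn2r ?nnegrE ?sqr_ge0//.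
(* The sign of [M] is read off at the point itself, from [0 <= |f x| <= M]. *)
by rewrite -real_normK ?num_real// lerXn2r ?nnegrE// (le_trans _ fxM).
Qed.

(** * Moments under the law of one observation, and independence of pairs *)

Lemma distribution_integral d d' (T : measurableType d)
    (T' : measurableType d') (R : realType) (P : probability T R)
    (Q : probability T' R) (X : {RV P >-> T'}) (f : T' -> \bar R) :
  (forall A, measurable A -> distribution P X A = Q A) ->
  measurable_fun [set: T'] f -> P.-integrable [set: T] (f \o X) ->
  (\int[Q]_y f y = \int[P]_x (f \o X) x)%E.
Proof.
move=> XQ mf fX; rewrite -integral_distribution//.
by apply: eq_measure_integral => A mA _; exact/esym/XQ.
Qed.

(** The change of variables for nonnegative functions asks for no integrability on the source space,
    so it can be applied to [f ^+ 2] first; the signed identities then follow from the integrability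
    obtained here. *)
Lemma Lfun2_comp d d' (T : measurableType d)
    (T' : measurableType d') (R : realType) (P : probability T R)
    (Q : probability T' R) (X : {RV P >-> T'}) (f : T' -> R) :
  (forall A, measurable A -> distribution P X A = Q A) ->
  f \in Lfun Q 2%:E -> f \o X \in Lfun P 2%:E.
Proof.
move=> XQ f2; have mf := Lfun2_measurable f2.
have mf2 : measurable_fun [set: T'] (fun y => (f y ^+ 2)%:E).
  by apply/measurable_EFinP; exact: measurable_funX.
apply: sqr_integral_lty_Lfun2; first exact: measurableT_comp.
have /integrableP[_] := Lfun2_integrable_sqr f2.
under eq_integral => x _ do rewrite /= ger0_norm ?sqr_ge0//.
rewrite (eq_measure_integral (distribution P X)); last first.
  by move=> A mA _; exact/esym/XQ.
by rewrite ge0_integral_distribution// => y; rewrite lee_fin sqr_ge0.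
Qed.

Lemma expectation_comp d d' (T : measurableType d)
    (T' : measurableType d') (R : realType) (P : probability T R)
    (Q : probability T' R) (X : {RV P >-> T'}) (f : T' -> R) :
  (forall A, measurable A -> distribution P X A = Q A) ->
  f \in Lfun Q 2%:E -> ('E_P[f \o X] = 'E_Q[f])%E.
Proof.
move=> XQ f2; rewrite unlock.
have fX1 := Lfun2_Lfun1 (Lfun2_comp XQ f2).
rewrite (distribution_integral XQ)//.
  by apply/measurable_EFinP; exact: Lfun2_measurable f2.
exact/Lfun1_integrable.
Qed.

(** A product measure is determined by its values on measurable rectangles, and there independence
    of the two indices gives the product of the marginals. *)
Lemma iid_pair_distribution d d' (Omega : measurableType d)
    (X : measurableType d') (R : realType) (P : probability Omega R)
    (O : nat -> {RV P >-> X}) (P0 : probability X R) (i j : nat)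
    (A : set (X * X)) :
  iid_from O P0 -> i != j -> measurable A ->
  (P0 \x P0)%E A = pushforward P (fun w => (O i w, O j w)) A.
Proof.
move=> [Oind Odist] ij mA.
have mO : measurable_fun [set: Omega] (fun w => (O i w, O j w)).
  by apply: measurable_fun_pair; exact: measurable_funPT.
pose O2 : {mfun Omega >-> (X * X)%type} := mfun_Sub (mem_set mO).
rewrite (@product_measure_unique _ _ _ _ _ P0 P0 (distribution P O2))//.
move=> B C mB mC.
(* Independence takes a family of sets indexed by all of [nat]; since [i != j], this one has value
   [B] at [i] and [C] at [j]. *)
pose F k := if k == i then B else C.
have mF k : measurable (F k) by rewrite /F; case: ifP.
have := Oind [:: i; j] F; rewrite /= inE ij => /(_ isT mF).
rewrite !big_cons big_nil mule1 /F eqxx (negPf (_ : j != i)) 1?eq_sym//.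
rewrite -(Odist i B)// -(Odist j C)// => <-; congr (P _); apply/seteqP; split => w /=.
  by move=> [Bw Cw] k /=; rewrite !inE => /orP[] /eqP->;
    rewrite ?eqxx// eq_sym (negPf ij).
move=> w_in; split.
  by have := w_in i; rewrite /= eqxx inE eqxx; exact.
by have := w_in j; rewrite /= !inE eqxx orbT eq_sym (negPf ij); exact.
Qed.

(** Fubini's theorem for the joint law [P0 \x P0] of the pair. *)
Lemma iid_expectationM d d' (Omega : measurableType d)
    (X : measurableType d') (R : realType) (P : probability Omega R)
    (O : nat -> {RV P >-> X}) (P0 : probability X R) (i j : nat)
    (f g : X -> R) :
  iid_from O P0 -> i != j -> f \in Lfun P0 2%:E -> g \in Lfun P0 2%:E ->
  'E_P[(f \o O i) \* (g \o O j)]%E = ('E_P0[f] * 'E_P0[g])%E.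
Proof.
move=> Oiid ij f2 g2; have [_ Odist] := Oiid.
pose h (z : X * X) := (f z.1 * g z.2)%:E.
have mh : measurable_fun [set: X * X] h.
  apply/measurable_EFinP; apply: measurable_funM.
    exact: measurableT_comp (Lfun2_measurable f2) measurable_fst.
  exact: measurableT_comp (Lfun2_measurable g2) measurable_snd.
have mO : measurable_fun [set: Omega] (fun w => (O i w, O j w)).
  by apply: measurable_fun_pair; exact: measurable_funPT.
have hO : P.-integrable [set: Omega] (h \o (fun w => (O i w, O j w))).
  apply/Lfun1_integrable; apply: Lfun2_mul_Lfun1.
    exact: Lfun2_comp (Odist i) f2.
  exact: Lfun2_comp (Odist j) g2.
have hpush := integrable_pushforward mO mh hO measurableT.
(* Integrability is obtained on [Omega], as a product of two square-integrable functions, and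
   carried to the product measure through the pushforward. *)
have hprod : (P0 \x P0)%E.-integrable [set: X * X] h.
  apply/integrableP; split => //; have /integrableP[_] := hpush.
  congr (_ < _)%E; apply: eq_measure_integral => A mA _.
  exact/esym/iid_pair_distribution.
transitivity (\int[P0 \x P0]_z h z)%E.
  rewrite unlock -[LHS](integral_pushforward mO mh hO measurableT).
  by apply: eq_measure_integral => A mA _; exact/esym/iid_pair_distribution.
rewrite -(integral12_prod_meas1 hprod) unlock /fubini_F /h /=.
have gfin := expectation_fin_num (Lfun2_Lfun1 g2); rewrite unlock in gfin.
under eq_integral => x _.
  under eq_integral => y _ do rewrite EFinM.
  rewrite integralZl//; last exact/Lfun1_integrable/Lfun2_Lfun1.
  (* The inner integral is finite, hence a real constant that can be pulled out of the outer
     integral. *)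
  rewrite -(fineK gfin).
  over.
rewrite /= integralZr//; last exact/Lfun1_integrable/Lfun2_Lfun1.
by rewrite fineK.
Qed.

Lemma iid_covariance0 d d' (Omega : measurableType d)
    (X : measurableType d') (R : realType) (P : probability Omega R)
    (O : nat -> {RV P >-> X}) (P0 : probability X R) (i j : nat)
    (f g : X -> R) :
  iid_from O P0 -> i != j -> f \in Lfun P0 2%:E -> g \in Lfun P0 2%:E ->
  covariance P (f \o O i) (g \o O j) = 0%E.
Proof.
move=> Oiid ij f2 g2; have [_ Odist] := Oiid.
have fO := Lfun2_comp (Odist i) f2; have gO := Lfun2_comp (Odist j) g2.
rewrite covarianceE ?Lfun2_mul_Lfun1 ?Lfun2_Lfun1//.
rewrite (iid_expectationM Oiid)//.
rewrite (expectation_comp (Odist i) f2) (expectation_comp (Odist j) g2).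
by rewrite subee// fin_numM// expectation_fin_num// Lfun2_Lfun1.
Qed.

(** * Mean, variance and weak law for empirical means *)

Section partial_sums.
Context d d' (Omega : measurableType d) (X : measurableType d') (R : realType).
Variables (P : probability Omega R) (O : nat -> {RV P >-> X}).
Variables (P0 : probability X R) (f : X -> R).
Hypotheses (Oiid : iid_from O P0) (f2 : f \in Lfun P0 2%:E).

Let S n w := \sum_(i < n) f (O i w).

Let fO i : f \o O i \in Lfun P 2%:E.
Proof. exact: Lfun2_comp (Oiid.2 i) f2. Qed.

Let S0 : S 0 = cst 0.
Proof. by apply/funext => w; rewrite /S big_ord0. Qed.

Let SS n : S n.+1 = S n \+ (f \o O n).
Proof. by apply/funext => w; rewrite /S big_ord_recr. Qed.

Let S2 n : S n \in Lfun P 2%:E.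
Proof.
elim: n => [|n IHn]; first by rewrite S0 Lfun_cst.
by rewrite SS rpredD ?lee1n.
Qed.

Let expectation_S n : 'E_P[S n]%E = (n%:R%:E * 'E_P0[f])%E.
Proof.
elim: n => [|n IHn]; first by rewrite S0 expectation_cst mul0e.
rewrite SS expectationD ?Lfun2_Lfun1// IHn (expectation_comp (Oiid.2 n) f2).
by rewrite -natr1 EFinD muleDl ?mul1e ?fin_num_adde_defl// expectation_fin_num// Lfun2_Lfun1.
Qed.

(** The sum [S n] involves only the indices below [n], so [j] is distinct from all of them. The case
    [j = n] removes the cross term when the variance of [S n.+1] is expanded. *)
Let covariance_S n j : (n <= j)%N -> covariance P (S n) (f \o O j) = 0%E.
Proof.
elim: n => [|n IHn] nj; first by rewrite S0 covariance_cst_l.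
rewrite SS covarianceDl// IHn 1?ltnW// (iid_covariance0 Oiid) ?adde0//.
by rewrite neq_ltn nj.
Qed.

Let variance_fO i : 'V_P[f \o O i]%E = 'V_P0[f]%E.
Proof.
rewrite !varianceE// (expectation_comp (Oiid.2 i) f2); congr (_ - _)%E.
rewrite unlock (distribution_integral (Oiid.2 i))//.
  by apply/measurable_EFinP; exact: measurable_funX 2 (Lfun2_measurable f2).
exact: Lfun2_integrable_sqr (fO i).
Qed.

Let variance_S n : 'V_P[S n]%E = (n%:R%:E * 'V_P0[f])%E.
Proof.
elim: n => [|n IHn]; first by rewrite S0 variance_cst mul0e.
rewrite SS varianceD// covariance_S// mule0 adde0 IHn variance_fO.
by rewrite -natr1 EFinD muleDl ?mul1e ?fin_num_adde_defl// variance_fin_num.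
Qed.

Let empirical_meanE n : empirical_mean O f n = n%:R^-1 \o* S n.
Proof. by apply/funext => w; rewrite /= mulrC. Qed.

Lemma empirical_mean_Lfun2 n : empirical_mean O f n \in Lfun P 2%:E.
Proof. by rewrite empirical_meanE Lfun_scale// ler1n. Qed.

Lemma expectation_empirical_mean n : (0 < n)%N ->
  'E_P[empirical_mean O f n]%E = 'E_P0[f]%E.
Proof.
move=> n0; rewrite empirical_meanE expectationZl ?Lfun2_Lfun1// expectation_S.
by rewrite muleA -EFinM mulVf ?mul1e// pnatr_eq0 -lt0n.
Qed.

Lemma variance_empirical_mean n :
  'V_P[empirical_mean O f n]%E = (n%:R^-1%:E * 'V_P0[f])%E.
Proof.
rewrite empirical_meanE varianceZ// variance_S muleA -EFinM; congr (_%:E * _)%E.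
(* At [n = 0] both sides vanish by the convention [0^-1 = 0], so the formula holds for every [n]. *)
have [->|n0] := eqVneq n%:R (0 : R); first by rewrite mulr0 invr0.
by rewrite expr2 -mulrA mulVf ?mulr1.
Qed.

Lemma empirical_mean_cvg_in_prob :
  cvg_in_prob P (empirical_mean O f) (fine 'E_P0[f]%E).
Proof.
move=> eps eps0.
have Vfin : ('V_P0[f])%E \is a fin_num by exact: variance_fin_num.
(* Chebyshev's bound for the empirical mean, whose variance is that of [f] divided by [n]. *)
pose b n : R := (eps ^- 2 * fine 'V_P0[f]%E) * n%:R^-1.
have bR : b n @[n --> \oo] --> (0 : R).
  rewrite -(mulr0 (eps ^- 2 * fine 'V_P0[f]%E)).
  by apply: cvgMr; exact: cvg_natV.
have b0 : (b n)%:E @[n --> \oo] --> 0%E by apply: cvg_EFin => //; near=> n.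
apply: squeeze_cvge (cvg_cst 0%E) b0.
near=> n; rewrite measure_ge0/=.
have n0 : (0 < n)%N by near: n; exists 1%N.
have m2 := empirical_mean_Lfun2 n.
pose Y : {RV P >-> R} := mfun_Sub (sub_Lfun_mfun m2).
have := chebyshev Y eps0.
rewrite -[Y : _ -> _]/(empirical_mean O f n).
rewrite variance_empirical_mean expectation_empirical_mean//.
rewrite -(fineK Vfin) -!EFinM [X in X%:E](_ : _ = b n); last by rewrite /b; ring.
apply: le_trans.
(* Chebyshev's inequality controls the event with [<=], which contains the strict event of
   [cvg_in_prob]. *)
rewrite le_measure ?inE//=.
- by apply: measurable_lt_dist; exact: Lfun2_measurable m2.
- have : measurable_fun [set: Omega]
      (fun w => eps <= `|empirical_mean O f n w - fine 'E_P0[f]%E|).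
    apply: measurable_fun_ler => //; apply: measurableT_comp => //.
    by apply: measurable_funB => //; exact: Lfun2_measurable m2.
  by move=> /(_ measurableT [set true] I); rewrite setTI.
- by move=> w /=; exact: ltW.
Unshelve. all: end_near. Qed.

End partial_sums.

(** * Scaled estimators and scaled variances *)

Lemma sandwich_measurable d d' (Omega : measurableType d)
    (X : measurableType d') (R : realType) (P : probability Omega R)
    (O : nat -> {RV P >-> X}) (Dhat : forall n, n.-tuple X -> X -> R) n :
  measurable_fun [set: n.-tuple X * X] (fun z => Dhat n z.1 z.2) ->
  measurable_fun [set: Omega] (sandwich O Dhat n).
Proof.
move=> mDhat.
have msample : measurable_fun [set: Omega] (sample O n).
  apply/measurable_fun_tnthP => i.
  rewrite (_ : _ \o _ = O i) ; first exact: measurable_funPT.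
  by apply/funext => w; rewrite /= tnth_mktuple.
rewrite /sandwich /empirical_mean.
apply: measurable_funM => //; apply: measurable_funM => //.
apply: measurable_sum => i; apply: measurable_funX.
(* The outcome [w] enters both through the sample that determines [Dhat n] and through the
   evaluation point, hence the use of joint measurability. *)
have mpair : measurable_fun [set: Omega] (fun w => (sample O n w, O i w)).
  by apply: measurable_fun_pair => //; exact: measurable_funPT.
exact: measurableT_comp mDhat mpair.
Qed.

(** A limit depends only on the tail; this discards [n = 0], where the factor [n%:R] cannot be
    cancelled. *)
Lemma eq_gt0_cvg_in_prob d (Omega : measurableType d) (R : realType)
    (P : probability Omega R) (Y Z : nat -> Omega -> R) (l : R) :
  (forall n, (0 < n)%N -> Y n =1 Z n) ->
  cvg_in_prob P Y l -> cvg_in_prob P Z l.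
Proof.
move=> YZ Yl eps eps0; apply: cvg_trans (Yl _ eps0); apply: near_eq_cvg.
near=> n; congr (P _); apply/seteqP.
have n0 : (0 < n)%N by near: n; exists 1%N.
by split => w /=; rewrite YZ.
Unshelve. all: end_near. Qed.

(** A Slutsky argument with deterministic denominators. Once [v n > l / 2], a ratio more than [eps]
    away from 1 forces [|Y n w - v n| > eps * l / 2]; as [|l - v n| <= eps * l / 4], there remains
    [|Y n w - l| > eps * l / 4]. *)
Lemma cvg_in_prob_div d (Omega : measurableType d) (R : realType)
    (P : probability Omega R) (Y : nat -> Omega -> R) (v : nat -> R) (l : R) :
  0 < l -> (forall n, measurable_fun [set: Omega] (Y n)) ->
  v n @[n --> \oo] --> l -> cvg_in_prob P Y l ->
  cvg_in_prob P (fun n w => Y n w / v n) 1.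
Proof.
move=> l0 mY vl Yl eps eps0.
have del0 : 0 < eps * l / 4 by rewrite divr_gt0 ?mulr_gt0.
apply: (squeeze_cvge _ (cvg_cst 0%E) (Yl _ del0)).
near=> n; rewrite measure_ge0 /=.
rewrite le_measure ?inE//=.
- by apply: measurable_lt_dist; exact: measurable_funM.
- exact: measurable_lt_dist.
move=> w /=.
have vd : `|l - v n| <= eps * l / 4 by by near: n; move/cvgrPdist_le : vl; apply.
have vhalf : l / 2 < v n.
  by near: n; apply: (cvgr_gt _ vl); lra.
have v0 : 0 < v n by lra.
rewrite -[X in _ - X](divff (lt0r_neq0 v0)) -mulrBl normrM normfV (gtr0_norm v0).
rewrite ltr_pdivlMr// => epsv.
have : `|Y n w - v n| <= `|Y n w - l| + `|l - v n|.
  by rewrite (le_trans _ (ler_normD _ _))// addrA subrK.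
have : eps * (l / 2) < eps * v n by rewrite ltr_pM2l.
lra.
Unshelve. all: end_near. Qed.

Lemma scaled_variance_cvg d (Omega : measurableType d) (R : realType)
    (P : probability Omega R) (A : nat -> Omega -> R)
    (B : nat -> {RV P >-> R}) (a b : R) :
  (forall n, A n \in Lfun P 2%:E) ->
  (n%:R%:E * 'V_P[A n])%E @[n --> \oo] --> a%:E ->
  (n%:R%:E * covariance P (A n) (B n))%E @[n --> \oo] --> 0%E ->
  (n%:R%:E * 'V_P[B n])%E @[n --> \oo] --> b%:E ->
  n%:R * fine 'V_P[(A n \+ B n)%R]%E @[n --> \oo] --> a + b.
Proof.
move=> A2 Aa AB0 Bb.
have /fine_cvgP[_ Aa'] := Aa; have /fine_cvgP[_ AB0'] := AB0.
have /fine_cvgP[Bfin Bb'] := Bb.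
(* The limit is put in the shape of the expanded variance, with twice the vanishing covariance as
   last term. *)
rewrite -(addr0 (a + b)) -[X in _ + X](mulr0 2).
apply: cvg_trans (cvgD (cvgD Aa' Bb') (cvgMr (a := 2) AB0')).
apply: near_eq_cvg; near=> n.
have n0 : n%:R != 0 :> R by rewrite pnatr_eq0 -lt0n; near: n; exists 1%N.
(* Square integrability of [B n] holds only eventually: the scaled variances have a real limit, so
   they are finite for large [n], while an infinite variance times a positive [n] would be
   infinite. *)
have B2 : (B n : _ -> _) \in Lfun P 2%:E.
  apply: variance_lty_Lfun2; rewrite ltey; apply/negP => /eqP Voo.
  have : (n%:R%:E * 'V_P[B n])%E \is a fin_num by near: n.
  by rewrite Voo mulry gtr0_sg ?mul1e// lt0r n0 /=.
have cfin : covariance P (A n) (B n) \is a fin_num.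
  by rewrite covariance_fin_num ?Lfun2_mul_Lfun1 ?Lfun2_Lfun1.
have VAfin := variance_fin_num (A2 n); have VBfin := variance_fin_num B2.
rewrite varianceD// !fctE /= -(fineK VAfin) -(fineK VBfin) -(fineK cfin) /=.
by ring.
Unshelve. all: end_near. Qed.

Theorem theorem4p1 (R : realType)
    (dX : measure_display) (X : measurableType dX)
    (model : set (probability X R)) (Psi : probability X R -> R)
    (P0 : probability X R) (hmodel : nonparametric_at model P0)
    (D : X -> R) (hD : efficient_influence_function model Psi P0 D)
    (sigma2 : R) (hsigma2 : ('E_P0[(fun x => D x ^+ 2)%R] = sigma2%:E)%E)
    (hsigma2_gt0 : 0 < sigma2)
    (M : R) (hM : {ae P0, forall x, `|D x| <= M})
    (dO : measure_display) (Omega : measurableType dO)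
    (P : probability Omega R)
    (O : nat -> {RV P >-> X}) (hO : iid_from O P0)
    (Psihat : forall n : nat, n.-tuple X -> R)
    (hPsihat : forall n, measurable_fun [set: n.-tuple X] (Psihat n))
    (Rrem : nat -> {RV P >-> R})
    (hexpansion : forall n w,
      Psihat n (sample O n w) - Psi P0 = empirical_mean O D n w + Rrem n w)
    (hRrem : bigO_in_prob P (fun n w => Rrem n w)
      (fun n => (Num.sqrt n%:R)^-1))
    (hcov : (n%:R%:E * covariance P (empirical_mean O D n) (Rrem n))%E
      @[n --> \oo] --> 0%E) :
  let err n w := Psihat n (sample O n w) - Psi P0 in
  let targets_EIF_variance (V : nat -> Omega -> R) :=
    cvg_in_prob P (fun n w => n%:R * V n w) sigma2 in
  targets_EIF_variance (sandwich O (fun n _ => D)) /\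
  forall (Dhat : forall n : nat, n.-tuple X -> X -> R)
    (hDhat : forall n, measurable_fun [set: n.-tuple X * X]
      (fun z => Dhat n z.1 z.2))
    (hsandwich : targets_EIF_variance (sandwich O Dhat)),
  ((n%:R%:E * 'V_P[Rrem n])%E @[n --> \oo] --> 0%E ->
    cvg_in_prob P (fun n w => sandwich O Dhat n w / fine ('V_P[err n])%E) 1) /\
  (forall cR : R, 0 < cR ->
    (n%:R%:E * 'V_P[Rrem n])%E @[n --> \oo] --> cR%:E ->
    targets_EIF_variance (sandwich O Dhat) /\
    (fun n => fine ('V_P[err n])%E - sigma2 / n%:R - cR / n%:R)
      =o_\oo (fun n => n%:R^-1 : R)).
Proof.
move=> err targets.
have [[[D2 ED] _] _] := hD.
have D22 := ae_bounded_Lfun2_sqr (Lfun2_measurable D2) hM.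
(* For [n > 0], [n] times this estimator is the empirical mean of [D ^+ 2], so the weak law
   applies. *)
have target_D : targets (sandwich O (fun n _ => D)).
  have := empirical_mean_cvg_in_prob hO D22; rewrite hsigma2 /=.
  apply: eq_gt0_cvg_in_prob => n n0 w.
  by rewrite /sandwich mulrC divfK// pnatr_eq0 -lt0n.
split=> // Dhat mDhat target_Dhat.
have VD : 'V_P0[D]%E = sigma2%:E.
  by rewrite varianceE// ED expe2 mule0 sube0.
have scaled_VDbar :
    (n%:R%:E * 'V_P[empirical_mean O D n])%E @[n --> \oo] --> sigma2%:E.
  apply: cvg_near_cst; near=> n.
  rewrite (variance_empirical_mean hO D2) VD muleA -!EFinM divff ?mul1r//.
  by rewrite pnatr_eq0 -lt0n; near: n; exists 1%N.
(* Both claims are instances: [c = 0] for the first and [c = cR] for the second. *)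
have scaled_Verr (c : R) : (n%:R%:E * 'V_P[Rrem n])%E @[n --> \oo] --> c%:E ->
    n%:R * fine 'V_P[err n]%E @[n --> \oo] --> sigma2 + c.
  move=> VR.
  have errE n : err n = empirical_mean O D n \+ Rrem n.
    by apply/funext => w; exact: hexpansion.
  under eq_fun do rewrite errE.
  exact: scaled_variance_cvg (empirical_mean_Lfun2 hO D2) scaled_VDbar hcov VR.
split=> [VR0 | cR cR0 VRc].
  have Verr : n%:R * fine 'V_P[err n]%E @[n --> \oo] --> sigma2.
    by rewrite -[sigma2]addr0; exact: scaled_Verr.
  have mV n : measurable_fun [set: Omega] (fun w => n%:R * sandwich O Dhat n w).
    by apply: measurable_funM => //; exact: sandwich_measurable.
  (* Numerator and denominator are both scaled by [n], which cancels for [n > 0]. *)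
  apply: eq_gt0_cvg_in_prob (cvg_in_prob_div hsigma2_gt0 mV Verr target_Dhat).
  by move=> n n0 w; rewrite -mulf_div divff ?mul1r// pnatr_eq0 -lt0n.
split=> //; apply/eqoP => eps eps0.
near=> n.
have n0 : 0 < n%:R :> R by rewrite ltr0n; near: n; exists 1%N.
(* Factoring out [n%:R^-1] leaves the gap between the scaled variance and its limit, so the little-o
   claim is exactly that convergence. *)
have -> : fine 'V_P[err n]%E - sigma2 / n%:R - cR / n%:R =
    - (sigma2 + cR - n%:R * fine 'V_P[err n]%E) * n%:R^-1.
  by field; rewrite lt0r_neq0.
rewrite normrM normrN ler_wpM2r//.
by near: n; move/cvgrPdist_le : (scaled_Verr _ VRc); apply.
Unshelve. all: end_near. Qed.
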